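(* Let $X$ be a set, $I$ a nonempty finite set and $(f_i)_{i\in I}$, $f_i:X\to X$, a family of functions having attractor. Then there exist a metric $d$ on $X$ and a comparison function $\varphi$ such that: a) the metric space $(X,d)$ is complete and bounded; b) for every $i\in I$, $f_i$ is a $\varphi$-contraction with respect to $d$.
   Context: $\mathbb{N}=\{0,1,2,\dots\}$ and $\mathbb{N}^*=\{1,2,\dots\}$. $\Lambda(I)=I^{\mathbb{N}^*}$ is the set of infinite words $\alpha=\alpha_1\alpha_2\dots$ with letters in $I$. For $\alpha\in\Lambda(I)$ and $n\in\mathbb{N}$, $[\alpha]_n=\alpha_1\dots\alpha_n$ if $n\ge 1$, and $[\alpha]_0=\lambda$ (the empty word). Put $f_\lambda=\mathrm{Id}_X$, $f_{\alpha_1\dots\alpha_m}=f_{\alpha_1}\circ\dots\circ f_{\alpha_m}$, and $X_\alpha=f_\alpha(X)$ for every finite word $\alpha$. Family having attractor: a family $(f_i)_{i\in I}$ of functions $f_i:X\to X$ with $I$ finite has attractor if: (a) for every $\alpha\in\Lambda(I)$ the set $\bigcap_{n\in\mathbb{N}}X_{[\alpha]_n}$ has a unique element, denoted $a_\alpha$; (b) if $\alpha,\beta\in\Lambda(I)$ and $a_\alpha\ne a_\beta$, then there exists $n_0\in\mathbb{N}$ such that $X_{[\alpha]_{n_0}}\cap X_{[\beta]_{n_0}}=\emptyset$. Comparison function: a function $\varphi:[0,\infty)\to[0,\infty)$ that is increasing (in the weak sense: $s\le t$ implies $\varphi(s)\le\varphi(t)$), satisfies $\varphi(t)<t$ for every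 $t>0$, and is right-continuous. $f:X\to X$ is a $\varphi$-contraction with respect to $d$ if $d(f(x),f(y))\le\varphi(d(x,y))$ for all $x,y\in X$. *)

(* Defs.v *)
From HB Require Import structures.
From mathcomp Require Import all_boot all_order all_algebra.
From mathcomp Require Import all_classical all_reals all_analysis.

Set Implicit Arguments.
Unset Strict Implicit.
Unset Printing Implicit Defensive.

Import Order.TTheory GRing.Theory Num.Theory.
Import numFieldNormedType.Exports.

Local Open Scope classical_set_scope.
Local Open Scope ring_scope.

(* An infinite word alpha_1 alpha_2 ... is w : nat -> I with w k = alpha_(k+1),
   so that its prefix of length n is mkseq w n. *)

Definition word_fun (I X : Type) (f : I -> X -> X) (s : seq I) : X -> X :=
  foldr (fun i g => f i \o g) id s.

Definition word_set (I X : Type) (f : I -> X -> X) (s : seq I) : set X :=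
  range (word_fun f s).

Definition has_attractor (I : finType) (X : Type) (f : I -> X -> X) : Prop :=
  exists a : (nat -> I) -> X,
    (forall w, \bigcap_n word_set f (mkseq w n) = [set a w]) /\
    (forall v w, a v <> a w ->
       exists n0, word_set f (mkseq v n0) `&` word_set f (mkseq w n0) = set0).

(* A function [0, oo) -> [0, oo) is a function R -> R whose values at negative
   arguments are irrelevant; the filter t^'+ only sees arguments > t. *)
Definition comparison_function (R : realType) (phi : R -> R) : Prop :=
  [/\ forall t, 0 <= t -> 0 <= phi t,
      forall s t, 0 <= s -> s <= t -> phi s <= phi t,
      forall t, 0 < t -> phi t < t &
      forall t, 0 <= t -> phi x @[x --> t^'+] --> phi t].

Definition phi_contraction (R : realType) (X : Type) (d : X -> X -> R)
    (phi : R -> R) (f : X -> X) : Prop :=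
  forall x y, d (f x) (f y) <= phi (d x y).

Record is_metric (R : realType) (X : Type) (d : X -> X -> R) : Prop := IsMetric {
  metric_ge0 : forall x y, 0 <= d x y;
  metric_eq0 : forall x y, d x y = 0 <-> x = y;
  metric_symm : forall x y, d x y = d y x;
  metric_tri : forall x y z, d x z <= d x y + d y z }.

(* The library's metric structure on X induced by d. *)
Definition metric_space (R : realType) (X : Type) (d : X -> X -> R)
  (hd : is_metric d) : Type := X.

Section MetricSpace.
Variables (R : realType) (X : Type) (d : X -> X -> R) (hd : is_metric d).
Local Notation M := (metric_space hd).

HB.instance Definition _ := Choice.copy M {classic X}.

Let dxx (x : M) : d x x = 0. Proof. exact/(metric_eq0 hd). Qed.

Let d_eq0 (x y : M) : d x y = 0 -> x = y. Proof. by move/(metric_eq0 hd). Qed.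

Let d_tri (y x z : M) : d x z <= d x y + d y z.
Proof. exact: metric_tri hd x y z. Qed.

HB.instance Definition _ :=
  @isMetric.Build R M d dxx d_eq0 (metric_symm hd) d_tri.

Lemma mdist_metric_space (x y : M) : mdist x y = d x y.
Proof. by []. Qed.

End MetricSpace.

Definition complete_metric (R : realType) (M : metricType R) : Prop :=
  forall u : nat -> M, cauchy (u @ \oo) -> exists l : M, u @ \oo --> l.

Definition bounded_metric (R : realType) (M : metricType R) : Prop :=
  exists C : R, forall x y : M, mdist x y <= C.

(* Main.v *)
Require Import Defs.
From HB Require Import structures.
From mathcomp Require Import all_boot all_order all_algebra.
From mathcomp Require Import all_classical all_reals all_analysis.
From mathcomp Require Import ring lra.

(** The proof has three independent layers.

    Topology. For each n, call two points adjacent at level n when they are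
    equal or lie in two cells X_s and X_t that meet, with |s| = |t| = n.  By a
    compactness argument on infinite words ([konig]), conditions (a) and (b) on
    the attractor make these relations a base of a separated uniformity: for
    each n there is m such that two steps at level m amount to one step at
    level n ([adjacent_comp]), and points adjacent at all levels coincide
    ([adjacent_separated]).  This uniformity has a countable base, so
    it comes from a metric p bounded by 2 ([metrization]).  Cells of long words
    are small for p.

    Contraction.  The maps f_i may increase p-distances, so p is replaced by
      d(x, y) = sup over words s of q_|s| p(f_s x, f_s y),
    where 1 = q_0 < q_1 < ... < 2.  Applying f_i only keeps the words that end
    with i and shortens them by one letter, so that each term is multiplied by
    r_n = 1 - 2^-(n+2) at most, where n is the length of the shortened word.
    These factors tend to 1, but the terms with large n are bounded by 2 e_n,
    with e_n the largest p-diameter of a cell of level n + 1, and e_n tends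
    to 0.  Hence d(f_i x, f_i y) <= phi(d(x, y)) for
      phi(t) = sup_n min(r_n t, 2 e_n).
    For t > 0, only finitely many n have 2 e_n > t / 2, hence phi(t) < t
    ([level_sup_comparison], [iterated_dist_contraction]).

    Completeness.  At each level, the points outside all cells are at distance
    at least some constant from all other points.  So a Cauchy sequence that
    ends up outside all cells of some level is eventually constant.  Otherwise,
    by compactness, it visits cells of all levels along one infinite word w,
    and tends to a_w because cells of long words are d-small
    ([complete_of_adjacent]). *)

Set Implicit Arguments.
Unset Strict Implicit.
Unset Printing Implicit Defensive.

(** * Words, cells and adjacency *)

Section Combinatorics.
Local Open Scope classical_set_scope.

(** Koenig's lemma.  A word is called good when it extends inside T to every
    length; by pigeonhole a good word has a good one-letter extension, and
    iterating such extensions from the empty word gives w. *)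
Lemma konig (J : finType) (T : seq J -> Prop)
    (Tprefix : forall s t, T (s ++ t) -> T s)
    (Tinf : forall n, exists s, size s = n /\ T s) :
  exists w : nat -> J, forall n, T (mkseq w n).
Proof.
pose good s := forall n, exists t, size t = n /\ T (s ++ t).
have good_rcons s : good s -> exists j, good (rcons s j).
  move=> gs; apply: contrapT => nex.
  have bad j : exists n, forall t, size t = n -> ~ T (rcons s j ++ t).
    apply: contrapT => nb; apply: nex; exists j => n.
    apply: contrapT => nt; apply: nb; exists n => t st Tt.
    by apply: nt; exists t.
  have [N badN] := choice bad.
  have [t [+ +]] := gs (\max_j N j).+1; case: t => //= j t [st].
  rewrite -cat_rcons -(cat_take_drop (N j) t) catA => /Tprefix.
  by apply: badN; rewrite size_takel // st leq_bigmax.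
have /choice[next nextP] s : exists j, good s -> good (rcons s j).
  have [[j]|ng] := pselect (exists j, good (rcons s j)); first by exists j.
  have [[j _]|noJ] := pselect (exists j : J, True).
    by exists j => /good_rcons.
  have [[|j t] [s1 _]] := Tinf 1%N; first by [].
  by case: noJ; exists j.
pose prefix n := iter n (fun s => rcons s (next s)) [::].
exists (next \o prefix) => n.
have -> : mkseq (next \o prefix) n = prefix n.
  by elim: n => // n IHn; rewrite mkseqS IHn.
have : good (prefix n) by elim: n => [|n IHn] //=; apply: nextP.
by case/(_ 0%N) => t [_ /Tprefix].
Qed.

Context {I : finType} {X : Type}.
Variable f : I -> X -> X.

Lemma word_fun_cat (s t : seq I) x :
  word_fun f (s ++ t) x = word_fun f s (word_fun f t x).
Proof. by elim: s => //= i s ->. Qed.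

Lemma word_set_prefix (s t : seq I) : word_set f (s ++ t) `<=` word_set f s.
Proof.
by move=> _ [x _ <-]; exists (word_fun f t x); rewrite ?word_fun_cat.
Qed.

Definition linked (s t : seq I) := word_set f s `&` word_set f t !=set0.

Lemma linked_prefix s s' t t' : linked (s ++ s') (t ++ t') -> linked s t.
Proof. by move=> [x [/word_set_prefix sx /word_set_prefix tx]]; exists x. Qed.

(** The entourages of the uniformity on X.  Using a single cell instead of two
    would not work: if two cells of level n meet in a single point z, then
    points on both sides of z, however close to z, may lie in no common cell of
    level n although each of them shares a deep cell with z. *)
Definition adjacent n x y := x = y \/ exists s t,
  [/\ size s = n, size t = n, word_set f s x, word_set f t y & linked s t].

Lemma adjacent_refl n x : adjacent n x x.
Proof. by left. Qed.

Lemma adjacent_sym n x y : adjacent n x y -> adjacent n y x.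
Proof.
move=> [->|[s [t [ss st sx ty [z [sz tz]]]]]]; first by left.
by right; exists t, s; split=> //; exists z.
Qed.

Lemma adjacent_le m n x y : (m <= n)%N -> adjacent n x y -> adjacent m x y.
Proof.
move=> mn [->|[s [t [ss st]]]]; first by left.
rewrite -(cat_take_drop m s) -(cat_take_drop m t).
move=> /word_set_prefix sx /word_set_prefix ty /linked_prefix st_linked.
right; exists (take m s), (take m t).
by split=> //; rewrite size_takel ?ss ?st.
Qed.

Lemma word_set_adjacent s x y :
  word_set f s x -> word_set f s y -> adjacent (size s) x y.
Proof. by move=> sx sy; right; exists s, s; split=> //; exists x. Qed.

Variable a : (nat -> I) -> X.
Hypothesis a_cap : forall w, \bigcap_n word_set f (mkseq w n) = [set a w].
Hypothesis a_sep : forall v w, a v <> a w ->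
  exists n, word_set f (mkseq v n) `&` word_set f (mkseq w n) = set0.

Lemma attractor_in w n : word_set f (mkseq w n) (a w).
Proof. by have : [set a w] (a w) by []; rewrite -a_cap; apply. Qed.

Lemma attractor_eq w x : (forall n, word_set f (mkseq w n) x) -> x = a w.
Proof.
by move=> wx; have : (\bigcap_n word_set f (mkseq w n)) x by []; rewrite a_cap.
Qed.

(** The only use of condition (b): cells that meet at every level lead to the
    same point. *)
Lemma attractor_linked v w :
  (forall n, linked (mkseq v n) (mkseq w n)) -> a v = a w.
Proof.
move=> l; apply: contrapT => /a_sep[n vw0]; have := l n.
by rewrite /linked vw0 => -[].
Qed.

(** The pairs of words of equal length that witness adjacency of x and y form a
    prefix-closed set, so they follow two infinite words v and w, and then
    x = a_v = a_w = y. *)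
Lemma adjacent_separated x y : (forall n, adjacent n x y) -> x = y.
Proof.
move=> adj; apply: contrapT => xy; apply: (xy).
pose T (u : seq (I * I)) := [/\ word_set f (unzip1 u) x,
  word_set f (unzip2 u) y & linked (unzip1 u) (unzip2 u)].
have [|n|w wT] := @konig _ T.
- rewrite /T /unzip1 /unzip2 => s t; rewrite !map_cat.
  by move=> [/word_set_prefix sx /word_set_prefix sy /linked_prefix].
- have [//|[s [t [ss st sx ty l]]]] := adj n.
  exists (zip s t); rewrite size_zip ss st minnn; split=> //.
  by rewrite /T unzip1_zip ?unzip2_zip ?ss ?st.
rewrite (@attractor_eq (fst \o w) x); last first.
  by move=> n; case: (wT n); rewrite /unzip1 -map_comp.
rewrite (@attractor_eq (snd \o w) y); last first.
  by move=> n; case: (wT n); rewrite /unzip2 -map_comp.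
apply: attractor_linked => n; case: (wT n).
by rewrite /unzip1 /unzip2 -!map_comp.
Qed.

(** If two steps at level m never amount to one step at level n, the failures
    give chains of four cells, of all levels m, each meeting the next.  In the
    limit the four infinite words lead to one point of the attractor, which
    lies both in the first and in the last cell of level n: this makes the
    end points adjacent at level n. *)
Lemma adjacent_comp n : exists m, forall x y z,
  adjacent m x y -> adjacent m y z -> adjacent n x z.
Proof.
apply: contrapT => nex.
pose p1 (j : I * I * (I * I)) := j.1.1.
pose p2 (j : I * I * (I * I)) := j.1.2.
pose p3 (j : I * I * (I * I)) := j.2.1.
pose p4 (j : I * I * (I * I)) := j.2.2.
pose T u := [/\ linked (map p1 u) (map p2 u), linked (map p2 u) (map p3 u),
  linked (map p3 u) (map p4 u) & exists x z,
  [/\ word_set f (map p1 u) x, word_set f (map p4 u) z & ~ adjacent n x z]].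
have Tprefix s t : T (s ++ t) -> T s.
  rewrite /T !map_cat.
  move=> [/linked_prefix ? /linked_prefix ? /linked_prefix ?].
  move=> [x [z [/word_set_prefix ? /word_set_prefix ? nxz]]].
  by split=> //; exists x, z.
have [//|m|w wT] := @konig _ T.
  (* Failure is used at a level at least n, so that a degenerate step x = y or
     y = z already makes x and z adjacent at level n. *)
  apply: contrapT => nT; apply: nex; exists (maxn m n) => x y z xy yz.
  apply: contrapT => nxz.
  case: (xy) => [xyE|].
    by apply: nxz; rewrite xyE; apply: adjacent_le yz; rewrite leq_maxr.
  case: (yz) => [yzE|].
    move=> _; apply: nxz; rewrite -yzE; apply: adjacent_le xy.
    by rewrite leq_maxr.
  move=> [s3 [s4 [e3 e4 yin3 zin4 l34]]] [s1 [s2 [e1 e2 xin1 yin2 l12]]].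
  pose u := zip (zip s1 s2) (zip s3 s4).
  have [u1 u2] : map p1 u = s1 /\ map p2 u = s2.
    rewrite (map_comp fst fst) (map_comp snd fst) -/(unzip1 u) unzip1_zip;
      last by rewrite !size_zip e1 e2 e3 e4.
    by rewrite -/unzip1 unzip1_zip ?e1 ?e2 // -/unzip2 unzip2_zip ?e1 ?e2.
  have [u3 u4] : map p3 u = s3 /\ map p4 u = s4.
    rewrite (map_comp fst snd) (map_comp snd snd) -/(unzip2 u) unzip2_zip;
      last by rewrite !size_zip e1 e2 e3 e4.
    by rewrite -/unzip1 unzip1_zip ?e3 ?e4 // -/unzip2 unzip2_zip ?e3 ?e4.
  have uT : T u.
    rewrite /T u1 u2 u3 u4; split=> //; first by exists y.
    by exists x, z.
  apply: nT; exists (take m u); split.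
    by rewrite size_takel // !size_zip e1 e2 e3 e4 !minnn leq_maxl.
  by apply: (Tprefix _ (drop m u)); rewrite cat_take_drop.
have a_ends : a (p1 \o w) = a (p4 \o w).
  transitivity (a (p2 \o w)).
    by apply: attractor_linked => k; case: (wT k); rewrite -!map_comp.
  transitivity (a (p3 \o w)).
    by apply: attractor_linked => k; case: (wT k); rewrite -!map_comp.
  by apply: attractor_linked => k; case: (wT k); rewrite -!map_comp.
have [_ _ _ [x [z []]]] := wT n; rewrite -!map_comp => xin zin; apply.
right; exists (mkseq (p1 \o w) n), (mkseq (p4 \o w) n).
rewrite !size_mkseq; split=> //; exists (a (p1 \o w)).
by split; [|rewrite a_ends]; exact: attractor_in.
Qed.

End Combinatorics.
(** * From a countable base of entourages to a metric *)

Section Metrization.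
Import Order.TTheory GRing.Theory Num.Theory numFieldNormedType.Exports.
Local Open Scope classical_set_scope.
Local Open Scope ring_scope.

(** The pseudometric structure attached to a uniformity with a countable base
    has balls of radius 2 equal to the whole space, so its extended distance is
    finite; separation makes it a metric.  The last two conclusions say that
    the metric induces the uniformity. *)
Lemma metrization (R : realType) (X : Type) (W : nat -> X -> X -> Prop)
    (Wrefl : forall n x, W n x x)
    (Wsym : forall n x y, W n x y -> W n y x)
    (Wle : forall m n x y, (m <= n)%N -> W n x y -> W m x y)
    (Wcomp : forall n, exists m, forall x y z, W m x y -> W m y z -> W n x z)
    (Wsep : forall x y, (forall n, W n x y) -> x = y) :
  exists p : X -> X -> R, [/\ is_metric p,
    forall x y, p x y <= 2,
    forall e, 0 < e -> exists n, forall x y, W n x y -> p x y <= e &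
    forall n, exists2 e, 0 < e & forall x y, p x y < e -> W n x y].
Proof.
pose E n : set (X * X) := [set xy | W n xy.1 xy.2].
have E_filter : Filter (filter_from setT E).
  apply: filter_from_filter; first by exists 0%N.
  move=> m n _ _; exists (maxn m n) => // xy Exy.
  by split; apply: Wle Exy; rewrite ?leq_maxl ?leq_maxr.
have E_diag A : filter_from setT E A -> (diagonal `<=` A)%relation.
  by move=> [n _ EA] [x y] xy; apply: EA; rewrite /E /= -[y]xy; exact: Wrefl.
have E_inv A : filter_from setT E A -> filter_from setT E (A^-1)%relation.
  by move=> [n _ EA]; exists n => // -[x y] /Wsym Wyx; apply: EA.
have E_split A : filter_from setT E A ->
    exists2 B, filter_from setT E B & (B \; B `<=` A)%relation.
  move=> [n _ EA]; have [m Wm] := Wcomp n; exists (E m); first by exists m.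
  by move=> [x z] [y Wxy Wyz]; apply: EA; exact: Wm Wxy Wyz.
pose T : uniformType := HB.pack {classic X}
  (@isUniform.Build {classic X} _ E_filter E_diag E_inv E_split).
have T_countable : countable_uniformity T.
  apply/countable_uniformityP; exists E => [A [n _ EA]|n].
    by exists n.
  by exists n.
pose M : pseudoMetricType R :=
  [the pseudoMetricType R of countable_uniform T_countable].
have fin (x y : M) : edist (x, y) \is a fin_num.
  apply/edist_finP; exists 2 => //.
  exact: countable_uniform.countable_uniform_bounded.
pose p (x y : M) : R := fine (edist (x, y)).
have entM A : @entourage M A <-> filter_from setT E A by [].
have p_small n : exists2 e, 0 < e & forall x y, p x y < e -> W n x y.
  have : @entourage M (E n) by apply/entM; exists n.
  rewrite -entourage_ballE => -[e /= e0 eE]; exists e => // x y pxy.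
  apply: (eE (x, y)); apply: (@edist_lt_ball R M e (x, y)).
  by rewrite -(fineK (fin x y)) lte_fin.
exists p; split=> [|x y|e e0|//].
- split=> [x y|x y|x y|x y z].
  + exact/fine_ge0/edist_ge0.
  + split=> [p0|->]; last by rewrite /p edist_refl.
    by apply: Wsep => n; have [e e0] := p_small n; apply; rewrite p0.
  + by rewrite /p edist_sym.
  + rewrite /p -fineD //; apply: fine_le; rewrite ?fin_numD ?fin //.
    exact: edist_triangle.
- rewrite -lee_fin /p fineK ?fin //; apply: edist_fin => //.
  exact: countable_uniform.countable_uniform_bounded.
- have : @entourage M [set xy | ball xy.1 e xy.2].
    exact: entourage_ball (PosNum e0).
  move=> /entM[n _ En]; exists n => x y Wxy.
  rewrite -lee_fin /p fineK ?fin //; apply: (@edist_fin R M e (x, y)) => //.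
  exact: (En (x, y)).
Qed.
End Metrization.
(** * The comparison function *)

Section Phi.
Import Order.TTheory GRing.Theory Num.Theory numFieldNormedType.Exports.
Local Open Scope classical_set_scope.
Local Open Scope ring_scope.
Context {R : realType}.

Definition level_sup (r e : nat -> R) (t : R) : R :=
  sup (range (fun n => Num.min (r n * t) (e n))).

Section LevelSup.
Variables (r e : nat -> R) (C : R).
Hypothesis e_le : forall n, e n <= C.

Lemma level_sup_ge n t : Num.min (r n * t) (e n) <= level_sup r e t.
Proof.
apply: ub_le_sup; last by exists n.
by exists C => _ [m _ <-]; rewrite ge_min e_le orbT.
Qed.

Lemma level_sup_le c t :
  (forall n, Num.min (r n * t) (e n) <= c) -> level_sup r e t <= c.
Proof.
move=> rec; apply: ge_sup => [|_ [n _ <-] //].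
by exists (Num.min (r 0%N * t) (e 0%N)), 0%N.
Qed.

Hypothesis r_ge0 : forall n, 0 <= r n.
Hypothesis r_lt1 : forall n, r n < 1.
Hypothesis r_homo : forall m n, (m <= n)%N -> r m <= r n.
Hypothesis e_ge0 : forall n, 0 <= e n.
Hypothesis e_small :
  forall c, 0 < c -> exists N, forall n, (N <= n)%N -> e n <= c.

(** For t > 0, the indices with e n <= t / 2 contribute at most t / 2, and the
    finitely many others at most r N * t < t.  Right-continuity holds because a
    supremum of 1-Lipschitz functions is 1-Lipschitz. *)
Lemma level_sup_comparison : comparison_function (level_sup r e).
Proof.
split=> [t t0|s t s0 st|t t0|t t0].
- by apply: le_trans (level_sup_ge 0 t); rewrite le_min mulr_ge0 ?e_ge0.
- apply: level_sup_le => n; apply: le_trans (level_sup_ge n t).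
  by rewrite le_min !ge_min lexx orbT andbT ler_wpM2l.
- have [N eN] : exists N, forall n, (N <= n)%N -> e n <= t / 2.
    by apply: e_small; rewrite divr_gt0.
  apply: (@le_lt_trans _ _ (Num.max (r N * t) (t / 2))).
    apply: level_sup_le => n; rewrite le_max !ge_min.
    have [/eN ->|/ltnW nN] := leqP N n; first by rewrite !orbT.
    by rewrite ler_wpM2r ?r_homo // ltW.
  by rewrite gt_max gtr_pMl // r_lt1 /=; lra.
- apply/cvgrPdist_le => c c0; near=> s.
  have ts : t <= s by apply: ltW; near: s; exact: nbhs_right_gt.
  have sc : s <= t + c.
    by apply: ltW; near: s; apply: nbhs_right_lt; rewrite ltrDl.
  have s_le : level_sup r e s <= level_sup r e t + c.
    apply: level_sup_le => n; rewrite -lerBlDr.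
    apply: le_trans (level_sup_ge n t); rewrite le_min !lerBlDr !ge_min.
    apply/andP; split; apply/orP; [left|right; lra].
    have := r_ge0 n; have := r_lt1 n; nra.
  have t_le : level_sup r e t <= level_sup r e s.
    apply: level_sup_le => n; apply: le_trans (level_sup_ge n s).
    by rewrite le_min !ge_min lexx orbT andbT ler_wpM2l.
  by rewrite ler_norml; apply/andP; split; lra.
Unshelve. all: by end_near.
Qed.

End LevelSup.

(** A strictly increasing sequence between 1 and 2, chosen so that the quotients
    of consecutive terms have a simple bound. *)
Definition weight n : R := 2 - 2^-1 ^+ n.

Lemma weight0 : weight 0 = 1.
Proof. by rewrite /weight expr0; lra. Qed.

Lemma weight_ge1 n : 1 <= weight n.
Proof.
have : (2^-1 : R) ^+ n <= 1 by apply: exprn_ile1; lra.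
by rewrite /weight; lra.
Qed.

Lemma weight_le2 n : weight n <= 2.
Proof.
have : 0 <= (2^-1 : R) ^+ n by apply: exprn_ge0; lra.
by rewrite /weight; lra.
Qed.

(** An upper bound for weight n / weight n.+1. *)
Definition ratio n : R := 1 - 2^-1 ^+ n.+2.

Lemma weight_ratio n : weight n <= ratio n * weight n.+1.
Proof.
have : 0 <= (2^-1 : R) ^+ n by apply: exprn_ge0; lra.
by rewrite /weight /ratio !exprS; nra.
Qed.

Lemma ratio_ge0 n : 0 <= ratio n.
Proof.
have : (2^-1 : R) ^+ n.+2 <= 1 by apply: exprn_ile1; lra.
by rewrite /ratio; lra.
Qed.

Lemma ratio_lt1 n : ratio n < 1.
Proof.
have : 0 < (2^-1 : R) ^+ n.+2 by apply: exprn_gt0; lra.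
by rewrite /ratio; lra.
Qed.

Lemma ratio_homo m n : (m <= n)%N -> ratio m <= ratio n.
Proof.
move=> mn; rewrite lerD2l lerN2; apply: ler_wiXn2l; lra || by [].
Qed.

End Phi.

(** * A metric for which the maps are contractions *)

Section Renorm.
Import Order.TTheory GRing.Theory Num.Theory numFieldNormedType.Exports.
Local Open Scope classical_set_scope.
Local Open Scope ring_scope.
Context {R : realType} {I : finType} {X : Type}.
Variables (f : I -> X -> X) (p : X -> X -> R) (C : R).
Hypothesis p_metric : is_metric p.
Hypothesis p_le : forall x y, p x y <= C.

Definition iterated_dist x y : R :=
  sup (range (fun s => weight (size s) * p (word_fun f s x) (word_fun f s y))).

Lemma weight_p_le n x y : weight n * p x y <= 2 * p x y.
Proof. by rewrite ler_wpM2r ?weight_le2 // (metric_ge0 p_metric). Qed.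

Lemma iterated_dist_ge s x y :
  weight (size s) * p (word_fun f s x) (word_fun f s y) <= iterated_dist x y.
Proof.
apply: ub_le_sup; last by exists s.
exists (2 * C) => _ [t _ <-]; apply: le_trans (weight_p_le _ _ _) _.
by rewrite ler_pM2l.
Qed.

Lemma iterated_dist_le c x y :
  (forall s, weight (size s) * p (word_fun f s x) (word_fun f s y) <= c) ->
  iterated_dist x y <= c.
Proof.
move=> pc; apply: ge_sup => [|_ [s _ <-] //].
by exists (weight (size (Nil I)) * p x y), [::].
Qed.

Lemma le_iterated_dist x y : p x y <= iterated_dist x y.
Proof. by have := iterated_dist_ge [::] x y; rewrite weight0 mul1r. Qed.

Lemma iterated_dist_bounded x y : iterated_dist x y <= 2 * C.
Proof.
apply: iterated_dist_le => s; apply: le_trans (weight_p_le _ _ _) _.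
by rewrite ler_pM2l.
Qed.

Lemma iterated_dist_metric : is_metric iterated_dist.
Proof.
have p_ge0 := metric_ge0 p_metric.
split=> [x y|x y|x y|x y z].
- exact: le_trans (p_ge0 x y) (le_iterated_dist x y).
- split=> [d0|->].
    by apply/(metric_eq0 p_metric)/le_anti; rewrite p_ge0 -d0 le_iterated_dist.
  apply: le_anti; apply/andP; split.
    by apply: iterated_dist_le => s; rewrite (metric_eq0 p_metric _ _).2 ?mulr0.
  exact: le_trans (p_ge0 y y) (le_iterated_dist y y).
- by rewrite /iterated_dist; under eq_fun do rewrite (metric_symm p_metric).
- apply: iterated_dist_le => s.
  apply: le_trans (lerD (iterated_dist_ge s x y) (iterated_dist_ge s y z)).
  rewrite -mulrDr ler_wpM2l ?(metric_tri p_metric) //.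
  exact: le_trans (weight_ge1 _).
Qed.

Hypothesis p_small : forall e, 0 < e -> exists N, forall s x y,
  (N <= size s)%N -> word_set f s x -> word_set f s y -> p x y <= e.

(** The points f_t x and f_t y of a term lie in the cell of t ++ s, which is at
    least as deep as that of s, so all terms are small together. *)
Lemma iterated_dist_small e : 0 < e -> exists N, forall s x y,
  (N <= size s)%N -> word_set f s x -> word_set f s y ->
  iterated_dist x y <= e.
Proof.
move=> e0; have [|N pN] := @p_small (e / 2); first by rewrite divr_gt0.
exists N => s _ _ Ns [x _ <-] [y _ <-]; apply: iterated_dist_le => t.
apply: le_trans (weight_p_le _ _ _) _; rewrite mulrC -ler_pdivlMr //.
rewrite -!word_fun_cat; apply: (pN (t ++ s)).
- by rewrite size_cat (leq_trans Ns) // leq_addl.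
- by exists x.
- by exists y.
Qed.

(** Twice the largest p-diameter of a cell of level n.+1; the factor 2 accounts
    for the weights. *)
Definition level_diam n : R := sup [set 2 * p (word_fun f v.1 v.2.1)
  (word_fun f v.1 v.2.2) | v in [set v : seq I * (X * X) | size v.1 = n.+1]].

Lemma level_diam_ge s i x y :
  2 * p (word_fun f s (f i x)) (word_fun f s (f i y)) <= level_diam (size s).
Proof.
apply: ub_le_sup; first by exists (2 * C) => _ [v _ <-]; rewrite ler_pM2l.
exists (rcons s i, (x, y)); rewrite /= ?size_rcons //.
by rewrite -cats1 !word_fun_cat.
Qed.

Lemma level_diam_le n c : 0 <= c ->
  (forall s x y, size s = n.+1 -> word_set f s x -> word_set f s y ->
    2 * p x y <= c) -> level_diam n <= c.
Proof.
move=> c0 pc.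
(* S is empty when there are no letters or no points; its supremum is then 0. *)
rewrite /level_diam; set S := (X in sup X).
have [->|/set0P S0] := eqVneq S set0; first by rewrite sup0.
apply: ge_sup => // _ [[s [x y]] /= sn <-].
by apply: pc sn _ _; [exists x | exists y].
Qed.

Lemma level_diam_ge0 n : 0 <= level_diam n.
Proof.
rewrite /level_diam; set S := (X in sup X).
have [->|/set0P[r Sr]] := eqVneq S set0; first by rewrite sup0.
have r0 : 0 <= r.
  by case: Sr => v _ <-; rewrite mulr_ge0 ?(metric_ge0 p_metric).
apply: le_trans r0 _; apply: ub_le_sup => //.
by exists (2 * C) => _ [v _ <-]; rewrite ler_pM2l.
Qed.

Lemma level_diam_bounded n : level_diam n <= 2 * `|C|.
Proof.
apply: level_diam_le => [|s x y _ _ _]; first by rewrite mulr_ge0.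
by rewrite ler_pM2l // (le_trans (p_le x y)) // ler_norm.
Qed.

(** The term of the word s at (f_i x, f_i y) is, up to its weight, the term of
    the word s i at (x, y).  The change of weight gives the bound
    ratio |s| * d(x, y), and both points lie in the cell of s i. *)
Lemma iterated_dist_contraction i :
  phi_contraction iterated_dist (level_sup ratio level_diam) (f i).
Proof.
move=> x y; apply: iterated_dist_le => s.
apply: le_trans (level_sup_ge _ level_diam_bounded (size s) _).
rewrite le_min; apply/andP; split; last first.
  exact: le_trans (weight_p_le _ _ _) (level_diam_ge _ _ _ _).
apply: (@le_trans _ _ (ratio (size s) *
    (weight (size s).+1 * p (word_fun f s (f i x)) (word_fun f s (f i y))))).
  by rewrite mulrA ler_wpM2r ?weight_ratio // (metric_ge0 p_metric).
rewrite ler_wpM2l ?ratio_ge0 //.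
have := iterated_dist_ge (rcons s i) x y.
by rewrite size_rcons -cats1 !word_fun_cat.
Qed.

Lemma level_diam_comparison :
  comparison_function (level_sup (ratio : nat -> R) level_diam).
Proof.
apply: (level_sup_comparison level_diam_bounded).
- exact: ratio_ge0.
- exact: ratio_lt1.
- exact: ratio_homo.
- exact: level_diam_ge0.
- move=> c c0; have [|N pN] := @p_small (c / 2); first by rewrite divr_gt0.
  exists N => n Nn; apply: level_diam_le; first exact: ltW.
  move=> s x y sn xs ys; rewrite mulrC -ler_pdivlMr //.
  by apply: (pN s); rewrite // sn ltnW.
Qed.

End Renorm.

(** * Completeness *)

Section Complete.
Import Order.TTheory GRing.Theory Num.Theory numFieldNormedType.Exports.
Local Open Scope classical_set_scope.
Local Open Scope ring_scope.
Context {R : realType} {I : finType} {X : Type}.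
Variables (f : I -> X -> X) (a : (nat -> I) -> X).
Hypothesis a_in : forall w n, word_set f (mkseq w n) (a w).
Variable d : X -> X -> R.
Hypothesis d_metric : is_metric d.
Hypothesis d_small : forall e, 0 < e -> exists N, forall s x y,
  (N <= size s)%N -> word_set f s x -> word_set f s y -> d x y <= e.
Hypothesis d_adjacent : forall n, exists2 e, 0 < e &
  forall x y, d x y < e -> adjacent f n x y.

(** A point in no cell of level n is adjacent only to itself at that level,
    hence at positive distance from all the others.  A Cauchy sequence that
    avoids all cells of level n from some rank on is thus eventually constant.
    Any other sequence visits cells of all levels. *)
Lemma complete_of_adjacent : complete_metric (metric_space d_metric).
Proof.
move=> u /cauchy_ballP u_cauchy.
have {}u_cauchy e : 0 < e -> exists N, forall k l,
    (N <= k)%N -> (N <= l)%N -> d (u k) (u l) < e.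
  move=> /u_cauchy [[A B] /= [[M _ MA] [N _ NB]] AB].
  exists (maxn M N) => k l; rewrite !geq_max => /andP[Mk _] /andP[_ Nl].
  rewrite -(@mdist_metric_space _ _ _ d_metric).
  have := AB (u k, u l); rewrite ballEmdist; apply; split=> /=.
    exact: MA.
  exact: NB.
suff [l ul] : exists l, forall e, 0 < e -> exists N, forall k,
    (N <= k)%N -> d l (u k) < e.
  exists (l : metric_space d_metric); apply/cvg_ballP => e /ul[N uN].
  by exists N => // k Nk; rewrite ballEmdist; exact: uN.
have [[n [M out]]|often] := pselect (exists n M, forall k s,
    (M <= k)%N -> size s = n -> ~ word_set f s (u k)).
  have [e e0 eadj] := d_adjacent n; have [N uN] := u_cauchy e e0.
  exists (u (maxn M N)) => c c0; exists (maxn M N) => k; rewrite geq_max.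
  move=> /andP[Mk Nk].
  have [<-|[s [t [_ st _ tk _]]]] := eadj _ _ (uN _ _ (leq_maxr M N) Nk).
    by rewrite (metric_eq0 d_metric _ _).2.
  by case: (out k t).
(* The condition size s <= k both makes the set of words prefix-closed and
   yields cells along w that are visited at arbitrarily late times. *)
have [s t [k sk stk]||w wT] := @konig I
    (fun s => exists2 k, (size s <= k)%N & word_set f s (u k)).
- exists k; last exact: word_set_prefix stk.
  by apply: leq_trans sk; rewrite size_cat leq_addr.
- move=> n; apply: contrapT => none; apply: often; exists n, n => k s nk sn sk.
  by apply: none; exists s; split=> //; exists k; rewrite ?sn.
exists (a w) => e e0.
have [N uN] := u_cauchy (e / 2) (divr_gt0 e0 (ltr0n _ 2)).
have [|M dM] := @d_small (e / 3); first by rewrite divr_gt0.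
exists N => k Nk; have [l] := wT (maxn M N); rewrite size_mkseq => MNl ul.
have al : d (a w) (u l) <= e / 3.
  by apply: dM (a_in w (maxn M N)) ul; rewrite size_mkseq leq_maxl.
have lk : d (u l) (u k) < e / 2.
  by apply: uN => //; apply: leq_trans MNl; rewrite leq_maxr.
by have := metric_tri d_metric (a w) (u l) (u k); lra.
Qed.

End Complete.

Theorem theorem3p21 (R : realType) (X : Type) (I : finType) (hI : (0 < #|I|)%N)
    (f : I -> X -> X) (hf : has_attractor f) :
  exists (d : X -> X -> R) (hd : is_metric d) (phi : R -> R),
    comparison_function phi /\
    (complete_metric (metric_space hd) /\ bounded_metric (metric_space hd)) /\
    (forall i : I, phi_contraction d phi (f i)).
Proof.
have [a [a_cap a_sep]] := hf.
have [p [p_metric p_le p_small p_adj]] := @metrization R X (adjacent f)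
  (@adjacent_refl _ _ f) (@adjacent_sym _ _ f) (@adjacent_le _ _ f)
  (adjacent_comp a_cap a_sep) (adjacent_separated a_cap a_sep).
have p_small_words e : (0 < e)%R -> exists N, forall s x y,
    (N <= size s)%N -> word_set f s x -> word_set f s y -> (p x y <= e)%R.
  move=> /p_small[N pN]; exists N => s x y Ns xs ys.
  by apply/pN/(adjacent_le Ns)/(word_set_adjacent xs ys).
exists (iterated_dist f p), (iterated_dist_metric f p_metric p_le).
exists (level_sup ratio (level_diam f p)).
split; first exact: level_diam_comparison p_metric p_le p_small_words.
split; first split.
- apply: (@complete_of_adjacent _ _ _ f a).
  + exact: attractor_in.
  + exact: iterated_dist_small p_metric p_small_words.
  + move=> n; have [e e0 pe] := p_adj n; exists e => // x y dxy.
    apply: pe; apply: Order.POrderTheory.le_lt_trans dxy.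
    exact: le_iterated_dist.
- exists (2 * 2)%R => x y; rewrite mdist_metric_space.
  exact: iterated_dist_bounded.
- by move=> i; exact: iterated_dist_contraction p_metric p_le i.
Qed.
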